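(* Let $C$ be a strict $d$-dimensional Archimedean copula and $\ell\in\{1,\ldots,d-2\}$. For any $\mathbf{x}\in(0,1)^\ell$ the conditional copula $C^{\mathbf{x}}$ of $C$ is a $(d-\ell)$-dimensional Archimedean copula.
   Context: $\mathbb{I}=[0,1]$. Archimedean copulas: a generator is a continuous, non-increasing function $\psi:[0,\infty)\to\mathbb{I}$ with $\psi(0)=1$, $\lim_{z\to\infty}\psi(z)=0$, strictly decreasing on $[0,\inf\{z\in[0,\infty]:\psi(z)=0\}]$ (with $\psi(\infty):=0$). $\varphi:(0,1]\to[0,\infty)$ denotes the pseudoinverse of $\psi$, and $\varphi(0):=\inf\{z\in[0,\infty]:\psi(z)=0\}\in(0,\infty]$. A $d$-dimensional copula $C$ is Archimedean with generator $\psi$ if $C(\mathbf{x})=\psi(\varphi(x_1)+\cdots+\varphi(x_d))$ for all $\mathbf{x}\in\mathbb{I}^d$; $C$ (and $\psi$) is strict if $\varphi(0)=\infty$. The right-hand side is a copula if and only if $\psi$ is $d$-monotone: $\psi$ is continuous on $[0,\infty)$, has derivatives $\psi^{(m)}$ up to order $d-2$ on $(0,\infty)$ with $(-1)^m\psi^{(m)}\ge0$ for $m=0,\ldots,d-2$, and $(-1)^{d-2}\psi^{(d-2)}$ is non-increasing and convex on $(0,\infty)$. Generators are unique only up to a positive scaling of the argument. Conditional copula: let $C$ be strict with generator $\psi$, $\ell\in\{1,\ldots,d-2\}$ and $\mathbf{x}\in(0,1)^\ell$. The $\ell$-Markov kernel of $C$ (regular conditional distribution of the last $d-\ell$ coordinates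 given the first $\ell$) is taken in the version $$K_C(\mathbf{x},[\mathbf{0},\mathbf{y}])=\frac{\psi^{(\ell)}\left(\sum_{i=1}^\ell\varphi(x_i)+\sum_{j=1}^{d-\ell}\varphi(y_j)\right)}{\psi^{(\ell)}\left(\sum_{i=1}^\ell\varphi(x_i)\right)},\qquad \mathbf{y}\in\mathbb{I}^{d-\ell},$$ with $\psi^{(\ell)}(\infty):=0$. Its univariate marginal distribution functions all equal $g_{\mathbf{x}}(y)=\psi^{(\ell)}\left(\sum_{i=1}^\ell\varphi(x_i)+\varphi(y)\right)/\psi^{(\ell)}\left(\sum_{i=1}^\ell\varphi(x_i)\right)$, which is an increasing bijection of $\mathbb{I}$ with inverse $g_{\mathbf{x}}^{-1}$. The conditional copula $C^{\mathbf{x}}$ is the copula of $K_C(\mathbf{x},\cdot)$, i.e. $$C^{\mathbf{x}}(\mathbf{u})=K_C(\mathbf{x},[0,g_{\mathbf{x}}^{-1}(u_1)]\times\cdots\times[0,g_{\mathbf{x}}^{-1}(u_{d-\ell})]),\qquad\mathbf{u}\in\mathbb{I}^{d-\ell}.$$ *)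

(* Defs.v *)
From mathcomp Require Import all_boot all_order all_algebra.
From mathcomp Require Import all_classical all_reals all_analysis.
Import Order.TTheory GRing.Theory Num.Theory.
Import numFieldNormedType.Exports.

Set Implicit Arguments.
Unset Strict Implicit.
Unset Printing Implicit Defensive.

Local Open Scope classical_set_scope.
Local Open Scope ring_scope.

Section Copulas.
Context {R : realType}.
Implicit Types (psi : R -> R) (d l n : nat).

Definition in_cube d (u : 'I_d -> R) : Prop := forall i, 0 <= u i <= 1.

(* Only the values of C on the unit cube matter. The alternating sum is the
   C-volume of the box with lower corner a and upper corner b. *)
Definition is_copula d (C : ('I_d -> R) -> R) : Prop :=
  [/\ forall u, in_cube u -> (exists i, u i = 0) -> C u = 0,
      forall u i, in_cube u -> (forall j, j != i -> u j = 1) -> C u = u i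
    & forall a b, in_cube a -> in_cube b -> (forall i, a i <= b i) ->
        0 <= \sum_(S : {set 'I_d})
               (-1) ^+ #|S| * C (fun i => if i \in S then a i else b i)].

(* f, given on [0, +oo[, extended to [0, +oo] by f(+oo) := 0; the value at -oo
   is never used. *)
Definition ext_infty (f : R -> R) (z : \bar R) : R :=
  if z is r%:E then f r else 0.

(* For a generator psi and 0 < t <= 1 the set below is a singleton, while for
   t = 0 it always contains +oo. *)
Definition pseudo_inverse psi (t : R) : \bar R :=
  ereal_inf [set z : \bar R | (0 <= z)%E /\ ext_infty psi z = t].

Definition is_generator psi : Prop :=
  [/\ {within `[0, +oo[, continuous psi},
      forall z : R, 0 <= z -> 0 <= psi z <= 1,
      forall z w : R, 0 <= z -> z <= w -> psi w <= psi z,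
      psi 0 = 1 /\ psi z @[z --> +oo] --> 0
    & forall z w : \bar R,
        (0 <= z)%E -> (z < w)%E -> (w <= pseudo_inverse psi 0)%E ->
        ext_infty psi w < ext_infty psi z].

Definition is_strict psi : Prop := pseudo_inverse psi 0 = +oo%E.

Definition archimedean_with d psi (C : ('I_d -> R) -> R) : Prop :=
  [/\ is_generator psi, is_copula C
    & forall x, in_cube x ->
        C x = ext_infty psi (\sum_(i < d) pseudo_inverse psi (x i))%E].

Definition archimedean_copula d (C : ('I_d -> R) -> R) : Prop :=
  exists psi, archimedean_with psi C.

(* K_C(x, [0, y]) *)
Definition markov_kernel psi l n (x : 'I_l -> R) (y : 'I_n -> R) : R :=
  ext_infty (psi^`(l))%classic
    (\sum_(i < l) pseudo_inverse psi (x i)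
     + \sum_(j < n) pseudo_inverse psi (y j))%E
  / ext_infty (psi^`(l))%classic (\sum_(i < l) pseudo_inverse psi (x i))%E.

Definition kernel_margin psi l (x : 'I_l -> R) (y : R) : R :=
  ext_infty (psi^`(l))%classic
    (\sum_(i < l) pseudo_inverse psi (x i) + pseudo_inverse psi y)%E
  / ext_infty (psi^`(l))%classic (\sum_(i < l) pseudo_inverse psi (x i))%E.

(* The inverse of the margin restricted to the unit interval *)
Definition kernel_quantile psi l (x : 'I_l -> R) : R -> R :=
  'pinv_(fun=> 0) `[0, 1] (kernel_margin psi x).

Definition conditional_copula psi l n (x : 'I_l -> R) (u : 'I_n -> R) : R :=
  markov_kernel psi x (fun j => kernel_quantile psi x (u j)).

End Copulas.

(* Main.v *)
Require Import Defs.
From mathcomp Require Import all_boot all_order all_algebra.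
From mathcomp Require Import all_classical all_reals all_analysis.
From mathcomp Require Import lra.
Import Order.TTheory GRing.Theory Num.Theory.
Import numFieldNormedType.Exports.
Local Open Scope ring_scope.

(** Let phi be the pseudo-inverse of psi, a the sum of the phi (x_i), and
    g z := psi^(l) (a + z) / psi^(l) a. The kernel is g (sum of the phi (y_j)) and
    its margins are g (phi y), so replacing each y_j by the quantile of u_j gives
    g (sum of the g^-1 (u_j)): the conditional copula has the Archimedean form
    with generator g ([conditional_copulaE]). What remains is that psi^(l) exists
    and behaves well enough for g to be a strict generator, and that g generates a
    copula in dimension d - l.

    Both follow from the fact that C is a copula, expressed without derivatives.
    In the coordinates given by phi, the volume of a box is an iterated difference
    of psi with the signs of a completely monotone function, so all these
    differences up to order d are nonnegative ([archimedean_diff_monotone]).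
    Differences of order at most 2 make a function nonincreasing and convex. Those
    of order 3 make its right derivative convex up to sign, hence continuous, so
    that the function is differentiable ([diff_monotone_is_derive]); and the
    opposite of the derivative has nonnegative differences up to one order less,
    as a limit of difference quotients ([diff_monotone_right_slope]). Iterating l
    times ([regular_derive1n]), (-1)^l psi^(l) has nonnegative differences up to
    order d - l >= 2, hence is convex and therefore continuous; it stays positive
    with limit 0 at infinity, which makes it strictly decreasing. So g is a strict
    generator, and reading the correspondence between differences and volumes
    backwards, it generates a copula ([archimedean_is_copula]). *)

Set Implicit Arguments.
Unset Strict Implicit.
Unset Printing Implicit Defensive.

(** * Iterated differences *)

(** The signs are those of the volume of a box: each step subtracts the shifted
    value, so a completely monotone F has nonnegative differences. M is the
    real line for the analysis, and the extended one for boxes that touch the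
    boundary of the cube. *)
Fixpoint adiff (M : nmodType) (V : zmodType) (F : M -> V) (hs : seq M) (z : M)
    : V :=
  if hs is h :: hs' then adiff F hs' z - adiff F hs' (z + h) else F z.

(** Splitting the subsets of x :: s according to whether they contain x turns the
    inclusion-exclusion sum into the recursion that defines [adiff]. *)
Lemma sum_subsets_adiff (I : finType) (M : nmodType) (A : pzRingType)
    (F : M -> A) (h : I -> M) (s : seq I) (z : M) :
  uniq s ->
  \sum_(S : {set I} | S \subset s) (-1) ^+ #|S| * F (z + \sum_(i in S) h i)
    = adiff F [seq h i | i <- s] z.
Proof.
elim: s z => [|x s IH] z /=.
  move=> _; rewrite (big_pred1 (finset.set0 : {set I})) => [|S].
    by rewrite cards0 expr0 mul1r big_set0 addr0.
  apply/fintype.subsetP/eqP => [S0|-> y]; last by rewrite inE.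
  by apply/finset.setP => y; rewrite inE; apply/negP => /S0; rewrite in_nil.
move=> /andP[xs us].
rewrite (bigID (fun S : {set I} => x \in S)) /= addrC -!IH //.
congr (_ + _).
  apply: eq_bigl => S.
  apply/andP/fintype.subsetP => [[/fintype.subsetP Ss xS] y yS|Ss].
    have := Ss y yS; rewrite inE => /predU1P[yx|//].
    by rewrite -yx yS in xS.
  split; last by apply: contra xs => /Ss.
  by apply/fintype.subsetP => y /Ss ys; rewrite inE ys orbT.
rewrite -sumrN (reindex_onto (fun S => x |: S) (fun S => S :\ x)) /=; last first.
  by move=> S /andP[_ xS]; rewrite finset.setD1K.
apply: eq_big => [S|S /andP[/andP[_ _] /eqP Sx]].
  rewrite finset.setU11 andbT.
  apply/andP/fintype.subsetP => [[/fintype.subsetP Ss /eqP Sx] y yS|Ss].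
    have := Ss y; rewrite !inE yS orbT => /(_ isT) /predU1P[yx|//].
    by move: yS; rewrite -Sx yx !inE eqxx.
  split; last first.
    by apply/eqP/finset.setU1K; apply: contra xs => /Ss.
  apply/fintype.subsetP => y; rewrite !inE => /predU1P[->|/Ss ->].
    by rewrite eqxx.
  by rewrite orbT.
have xS : x \notin S by rewrite -Sx !inE eqxx.
by rewrite cardsU1 xS add1n exprS mulN1r mulNr big_setU1 //= addrA.
Qed.

Lemma sum_sets_adiff (I : finType) (M : nmodType) (A : pzRingType)
    (F : M -> A) (h : I -> M) (z : M) :
  \sum_(S : {set I}) (-1) ^+ #|S| * F (z + \sum_(i in S) h i)
    = adiff F [seq h i | i <- enum I] z.
Proof.
rewrite -sum_subsets_adiff ?enum_uniq //; apply: eq_bigl => S.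
by apply/esym/fintype.subsetP => i _; rewrite mem_enum.
Qed.

Section DiffMonotone.
Variable R : realType.
Implicit Types (f : R -> R) (hs : seq R) (n : nat).

Lemma adiff_quotient f hs (h z : R) :
  adiff (fun w => (f w - f (w + h)) / h) hs z = adiff f (h :: hs) z / h.
Proof.
elim: hs z => //= k hs IH z.
by rewrite !IH /= -mulrBl (addrAC z k h); congr (_ / _); lra.
Qed.

(** The derivative-free counterpart of n-monotonicity: it passes to pointwise
    limits, and it is what nonnegativity of the volumes of boxes provides. *)
Definition diff_monotone n f : Prop := forall hs, (size hs <= n)%N ->
  all (fun h => 0 <= h) hs -> forall z, 0 < z -> 0 <= adiff f hs z.

Lemma diff_monotone_noninc n f z h :
  diff_monotone n.+1 f -> 0 < z -> 0 <= h -> f (z + h) <= f z.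
Proof.
move=> fn z0 h0; have := fn [:: h]; rewrite /= andbT => /(_ isT h0 z z0).
by rewrite subr_ge0.
Qed.

Lemma diff_monotone_increment n f z h k :
  diff_monotone n.+2 f -> 0 < z -> 0 <= h -> 0 <= k ->
  f (z + k) - f (z + k + h) <= f z - f (z + h).
Proof.
move=> fn z0 h0 k0; have := fn [:: k; h]; rewrite /= h0 k0.
by move=> /(_ isT isT z z0); rewrite subr_ge0.
Qed.

(** Convexity, in the form: the slope of a chord decreases in absolute value when
    the chord gets longer. Nonnegative second differences give this only for
    commensurable lengths, in general; monotonicity of f fills the gap, without
    any appeal to continuity. *)
Lemma diff_monotone_slope n f z h k :
  diff_monotone n.+2 f -> 0 < z -> 0 < h -> h <= k ->
  h * (f z - f (z + k)) <= k * (f z - f (z + h)).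
Proof.
move=> fn z0 h0 hk.
set D := f z - f (z + h).
have D0 : 0 <= D.
  by rewrite subr_ge0; apply: (diff_monotone_noninc fn z0); exact: ltW.
(* The segment of length h is cut into N equal steps. Increments decrease, so
   the average increment over the m + 1 >= N steps needed to pass k is at most
   the average over the first N; the rounding costs at most one step. *)
have main N : (0 < N)%N -> f z - f (z + k) <= (k / h + N%:R^-1) * D.
  move=> N0; have N0R : 0 < N%:R :> R by rewrite ltr0n.
  set e := h / N%:R; have e0 : 0 < e by rewrite divr_gt0.
  pose a i := f (z + e *+ i) - f (z + e *+ i.+1).
  have eS i : z + e *+ i.+1 = z + e *+ i + e by rewrite mulrSr addrA.
  have aS i : a i.+1 <= a i.
    have zi : 0 < z + e *+ i by rewrite ltr_wpDr // mulrn_wge0 // ltW.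
    have := diff_monotone_increment fn zi (ltW e0) (ltW e0).
    by rewrite /a !eS.
  have amono i j : (i <= j)%N -> a j <= a i.
    move=> /subnK <-; elim: (j - i)%N => // m IHm.
    by rewrite addSn; exact: le_trans (aS _) IHm.
  have asum m : f z - f (z + e *+ m) = \sum_(0 <= i < m) a i.
    elim: m => [|m IHm]; first by rewrite mulr0n addr0 subrr big_geq.
    by rewrite big_nat_recr //= -IHm /a; lra.
  have eN : e *+ N = h by rewrite -mulr_natr divfK // gt_eqF.
  have aN m : (N <= m)%N -> N%:R * (f z - f (z + e *+ m)) <= m%:R * D.
    have -> : D = \sum_(0 <= i < N) a i by rewrite -asum eN.
    move=> /subnK <-; elim: (m - N)%N => [|p IHp]; first by rewrite asum.
    rewrite addSn -addn1 natrD mulrDl mul1r.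
    have -> : f z - f (z + e *+ (p + N + 1)) =
        (f z - f (z + e *+ (p + N))) + a (p + N)%N.
      by rewrite /a addn1; lra.
    rewrite mulrDr lerD // mulr_natl -[X in _ *+ X]subn0 -sumr_const_nat.
    rewrite big_nat_cond [X in _ <= X]big_nat_cond; apply: ler_sum => i.
    rewrite andbT => /andP[_ iN]; apply: amono.
    by rewrite ltnW // (leq_trans iN) // leq_addl.
  set m := Num.truncn (k / e).
  have ke0 : 0 <= k / e by rewrite divr_ge0 // ltW // (lt_le_trans h0).
  have /andP[m1 m2] := truncn_itv ke0.
  have Nm : (N <= m.+1)%N.
    rewrite ltnW // -(ltr_nat R); apply: le_lt_trans m2.
    by rewrite ler_pdivlMr // mulr_natl eN.
  have kem : k <= e *+ m.+1.
    by rewrite -mulr_natl -ler_pdivrMr // ltW.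
  have h1 : f z - f (z + k) <= f z - f (z + e *+ m.+1).
    have -> : z + e *+ m.+1 = (z + k) + (e *+ m.+1 - k) by lra.
    rewrite lerB //; apply: (diff_monotone_noninc fn); rewrite ?subr_ge0 //.
    by rewrite addr_gt0 // (lt_le_trans h0).
  apply: (le_trans h1).
  have := aN _ Nm; rewrite -ler_pdivlMl // => /le_trans; apply.
  rewrite mulrA ler_wpM2r // mulrC -natr1 mulrDl mul1r lerD2r.
  by rewrite ler_pdivrMr // (le_trans m1) // /e invf_div mulrA mulrAC.
suff : f z - f (z + k) <= k / h * D.
  by rewrite mulrAC ler_pdivlMr // mulrC.
apply/ler_addgt0Pr => e e0.
have := truncnS_gt (D / e).
set N := (Num.truncn (D / e)).+1 => DN.
apply: (le_trans (main N isT)).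
rewrite mulrDl lerD2l ler_pdivrMl ?ltr0n //.
by rewrite -ler_pdivrMr // ltW.
Qed.

End DiffMonotone.

(** * Differentiability from third differences *)

Section Derivative.
Variable R : realType.
Implicit Types (f : R -> R) (hs : seq R) (n : nat).
Local Open Scope classical_set_scope.

(** The chord over [y, y + c] is at least as steep as any chord to its right,
    which gives a Lipschitz constant on [y + c, +oo[. *)
Lemma diff_monotone_lipschitz n f (y c z h : R) :
  diff_monotone n.+2 f -> 0 < y -> 0 < c -> y + c <= z -> 0 < h ->
  f z - f (z + h) <= h * ((f y - f (y + c)) / c).
Proof.
move=> fn y0 c0 ycz h0.
have yc0 : 0 < y + c by rewrite addr_gt0.
have zE : z = y + c + (z - (y + c)) by lra.
have k0 : 0 <= z - (y + c) by rewrite subr_ge0.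
have := diff_monotone_increment fn yc0 (ltW h0) k0; rewrite -zE.
move=> /le_trans; apply.
have cch : c <= c + h by lra.
have := diff_monotone_slope fn y0 c0 cch.
rewrite mulrA ler_pdivlMr // (addrA y c h).
by move=> ?; nra.
Qed.

(** Minus the right derivative, for a convex f. *)
Definition right_slope f (z : R) : R :=
  sup [set (f z - f (z + h)) / h | h in `]0, +oo[].

Lemma has_ubound_slopes n f (z : R) : diff_monotone n.+2 f -> 0 < z ->
  has_ubound [set (f z - f (z + h)) / h | h in `]0, +oo[].
Proof.
move=> fn z0.
exists ((f (z / 2) - f (z / 2 + z / 2)) / (z / 2)) => _ [h /= h0 <-].
move: h0; rewrite in_itv/= andbT => h0; rewrite ler_pdivrMr // mulrC.
by apply: (diff_monotone_lipschitz fn) => //; lra.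
Qed.

Lemma right_slope_cvg n f (z : R) : diff_monotone n.+2 f -> 0 < z ->
  (f z - f (z + h)) / h @[h --> 0^'+] --> right_slope f z.
Proof.
move=> fn z0; apply: nonincreasing_at_right_cvgr => //.
  move=> h k; rewrite !in_itv/= !andbT => h0 k0 hk.
  rewrite ler_pdivrMr // mulrAC ler_pdivlMr // mulrC.
  by rewrite [leRHS]mulrC; apply: (diff_monotone_slope fn).
exact: (has_ubound_slopes fn).
Qed.

Lemma right_slope_ge n f z h : diff_monotone n.+2 f -> 0 < z -> 0 < h ->
  (f z - f (z + h)) / h <= right_slope f z.
Proof.
move=> fn z0 h0; apply: ub_le_sup; first exact: (has_ubound_slopes fn).
by exists h => //=; rewrite in_itv/= h0.
Qed.

(** With [right_slope_ge]: the slope of a chord lies between the values of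
    [right_slope] at its endpoints. *)
Lemma right_slope_le n f z h : diff_monotone n.+2 f -> 0 < z -> 0 < h ->
  right_slope f (z + h) <= (f z - f (z + h)) / h.
Proof.
move=> fn z0 h0; apply: ge_sup.
  by exists ((f (z + h) - f (z + h + 1)) / 1), 1 => //=; rewrite in_itv/= ltr01.
move=> _ [k /= k0 <-]; move: k0; rewrite in_itv/= andbT => k0.
rewrite ler_pdivrMr // mulrAC ler_pdivlMr //.
have hk : h <= h + k by lra.
have := diff_monotone_slope fn z0 h0 hk; rewrite addrA.
by move=> ?; nra.
Qed.

(** One order of monotonicity is traded for one derivative: an iterated
    difference of the difference quotient of f is an iterated difference of f
    with one more step, and nonnegativity survives the limit. *)
Lemma diff_monotone_right_slope n f :
  diff_monotone n.+3 f -> diff_monotone n.+2 (right_slope f).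
Proof.
move=> fn hs shs hs0 z z0.
suff cv : adiff (fun w => (f w - f (w + h)) / h) hs z @[h --> 0^'+]
    --> adiff (right_slope f) hs z.
  apply: (cvgr_to_ge cv).
  near=> h.
  rewrite adiff_quotient divr_ge0 //; apply: fn => //.
  by rewrite /= hs0 andbT.
have {}fn : diff_monotone n.+2 f by move=> ks kn; apply: fn; exact: ltnW.
elim: hs hs0 z z0 {shs} => [_ z z0|k hs IH /= /andP[k0 hs0] z z0] /=.
  exact: (right_slope_cvg fn).
apply: cvgB; apply: IH => //.
by rewrite ltr_wpDr.
Unshelve. all: by end_near. Qed.

Lemma diff_monotone_near_lipschitz n f (z : R) : diff_monotone n.+2 f -> 0 < z ->
  exists2 K, 0 <= K & forall w h, z / 2 <= w -> 0 < h ->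
    f w - f (w + h) <= h * K.
Proof.
move=> fn z0; pose c := z / 4; have c0 : 0 < c by rewrite divr_gt0.
exists ((f c - f (c + c)) / c).
  apply: divr_ge0; last exact: ltW.
  by rewrite subr_ge0; apply: (diff_monotone_noninc fn) => //; exact: ltW.
move=> w h zw h0; apply: (diff_monotone_lipschitz fn) => //.
by rewrite /c; lra.
Qed.

(** A chord of f has a slope between the values of [right_slope f] at its
    endpoints. Third differences make [right_slope f] convex in turn, hence
    locally Lipschitz, so the one-sided derivative is a two-sided one, with a
    linear error bound. *)
Lemma diff_monotone_is_derive n f (z : R) : diff_monotone n.+3 f -> 0 < z ->
  is_derive z 1 f (- right_slope f z).
Proof.
move=> fn z0.
have rn := diff_monotone_right_slope fn.
have [K K0 lip] := diff_monotone_near_lipschitz rn z0.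
suff cv : h^-1 *: ((f \o shift z) (h *: 1) - f z) @[h --> 0^']
    --> - right_slope f z.
  apply: DeriveDef; last exact: cvg_lim cv.
  by apply/cvg_ex; exists (- right_slope f z).
apply/subr_cvg0; apply: (@cvg_to_0_linear _ _ K (z / 2)); first by lra.
have {}fn : diff_monotone n.+2 f by move=> ks kn; apply: fn; exact: ltnW.
move=> h /andP[h0 hz]; rewrite /= /GRing.scale /= mulr1 opprK (addrC h z).
have [h_lt0|h_gt0|h00] := ltgtP h 0; last by rewrite h00 normr0 ltxx in h0.
  rewrite ltr0_norm // in hz *.
  have zh0 : 0 < z + h by lra.
  have hN0 : 0 < - h by lra.
  have := right_slope_ge fn zh0 hN0; have := right_slope_le fn zh0 hN0.
  have zh2 : z / 2 <= z + h by lra.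
  have := lip (z + h) (- h) zh2 hN0; rewrite addrK => h1 h2 h3.
  have -> : h^-1 * (f (z + h) - f z) = - ((f (z + h) - f z) / - h).
    by rewrite invrN mulrN opprK mulrC.
  rewrite ler0_norm; last by lra.
  by lra.
rewrite gtr0_norm // in hz *.
have := right_slope_ge fn z0 h_gt0; have := right_slope_le fn z0 h_gt0.
have zh2 : z / 2 <= z by lra.
have := lip z h zh2 h_gt0 => h1 h2 h3.
have -> : h^-1 * (f (z + h) - f z) = - ((f z - f (z + h)) / h).
  by rewrite mulrC -mulNr opprB.
by rewrite ger0_norm; lra.
Qed.

Lemma diff_monotone_continuous n f (z : R) : diff_monotone n.+2 f -> 0 < z ->
  {for z, continuous f}.
Proof.
move=> fn z0.
have [K K0 lip] := diff_monotone_near_lipschitz fn z0.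
have z20 : 0 < z/2 by lra.
have bound w : z / 2 <= w -> `|f z - f w| <= K * `|z - w|.
  move=> zw; have [wz|zw'|->] := ltgtP w z; last by rewrite !subrr !normr0 mulr0.
    have dw : 0 < z - w by lra.
    have := lip w (z - w) zw dw; rewrite (addrC w) subrK => h1.
    have := diff_monotone_noninc fn (lt_le_trans z20 zw) (ltW dw).
    rewrite (addrC w) subrK => h2.
    by rewrite ler0_norm ?gtr0_norm //; lra.
  have dw : 0 < w - z by lra.
  have zz : z / 2 <= z by lra.
  have := lip z (w - z) zz dw; rewrite (addrC z) subrK => h1.
  have := diff_monotone_noninc fn z0 (ltW dw).
  rewrite (addrC z) subrK => h2.
  by rewrite ger0_norm ?ltr0_norm //; lra.
apply/cvgrPdist_le => /= e e0; near=> w.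
have zw : z / 2 < w by near: w; apply: lt_nbhsr; lra.
apply: (le_trans (bound w (ltW zw))).
apply: (@le_trans _ _ ((K + 1) * (e / (K + 1)))); last first.
  by rewrite mulrC divfK // gt_eqF //; lra.
apply: ler_pM => //; first by lra.
near: w; apply: cvgr_dist_le; first exact: cvg_id.
by rewrite divr_gt0 //; lra.
Unshelve. all: by end_near. Qed.
End Derivative.

(** * Derivatives of all orders *)

Section Regular.
Variable R : realType.
Implicit Types (f g : R -> R) (n : nat).
Local Open Scope classical_set_scope.

(** The invariant kept by differentiation, up to sign. Positivity and the limit 0
    are what makes a rescaled shift of f a strict generator; behaviour at 0 is
    left out because the derivatives of a generator may blow up there. *)
Definition regular n f : Prop :=
  [/\ diff_monotone n f, forall z, 0 < z -> 0 < f z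
    & forall e, 0 < e -> exists2 A, 0 < A & forall z, A <= z -> f z < e].

Lemma eq_regular n f g : (forall z, 0 < z -> f z = g z) ->
  regular n f -> regular n g.
Proof.
move=> fg [fn fpos fvan]; split=> [hs shs hs0 z z0|z z0|e e0].
- rewrite -(_ : adiff f hs z = adiff g hs z); first exact: fn.
  elim: hs hs0 z z0 {shs} => [_|k hs IH /= /andP[k0 hs0]] z z0 /=; first exact: fg.
  by rewrite !IH // ltr_wpDr.
- by rewrite -fg // fpos.
- have [A A0 HA] := fvan e e0; exists A => // z Az.
  by rewrite -fg ?HA // (lt_le_trans A0).
Qed.

(** If f were constant on a chord, convexity would keep it above f z from then
    on, against the limit 0. *)
Lemma regular_decr n f z h : regular n.+2 f -> 0 < z -> 0 < h ->
  f (z + h) < f z.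
Proof.
move=> [fn fpos fvan] z0 h0; rewrite ltNge; apply/negP => fzh.
have [A A0 HA] := fvan _ (fpos z z0).
have := diff_monotone_slope fn z0 h0 (_ : h <= h + A).
rewrite lerDl ltW // => /(_ isT).
have fA : f (z + (h + A)) < f z by apply: HA; lra.
by move=> ?; nra.
Qed.

(** Where the slope vanished, convexity would keep f from decreasing
    afterwards, against the limit 0; and the slope tends to 0 because chords of
    length 1 dominate it. *)
Lemma regular_right_slope n f : regular n.+3 f -> regular n.+2 (right_slope f).
Proof.
move=> [fn fpos fvan]; have rn := diff_monotone_right_slope fn.
have {}fn : diff_monotone n.+2 f by move=> ks kn; apply: fn; exact: ltnW.
split=> // [z z0|e e0].
  have [A A0 HA] := fvan _ (fpos z z0).
  apply: lt_le_trans (right_slope_ge fn z0 A0).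
  by rewrite divr_gt0 // subr_gt0 HA //; lra.
have [A A0 HA] := fvan _ e0; exists (A + 1); first by lra.
move=> z Az; have zE : z = (z - 1) + 1 by lra.
have z1 : 0 < z - 1 by lra.
rewrite zE; apply: le_lt_trans (right_slope_le fn z1 ltr01) _.
have fz : 0 < f z by apply: fpos; lra.
have fz1 : f (z - 1) < e by apply: HA; lra.
by rewrite divr1 -zE; lra.
Qed.

Lemma regular_derive1n d m f : (m.+2 <= d)%N -> regular d f ->
  regular (d - m) (fun z => (-1) ^+ m * (f^`(m))%classic z).
Proof.
move=> md fd; elim: m md => [|m IH] md.
  by rewrite subn0; apply: eq_regular fd => z _; rewrite expr0 mul1r.
have /IH : (m.+2 <= d)%N by exact: ltnW.
set g := fun z => _; move=> gd.
have dE : (d - m = (d - m.+3).+3)%N by rewrite -{1}(subnK md) -3!addSnnS addnK.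
have -> : (d - m.+1 = (d - m.+3).+2)%N by rewrite -{1}(subnK md) -2!addSnnS addnK.
rewrite dE in gd; apply: eq_regular (regular_right_slope gd) => z z0.
have [gm _ _] := gd.
have gD := diff_monotone_is_derive gm z0.
have fE : f^`(m)%classic = (-1) ^+ m \*: g.
  by apply/funext => w; rewrite /g /= /GRing.scale /= mulrA -expr2 sqrr_sign mul1r.
rewrite derive1nS derive1E fE deriveZ // derive_val /GRing.scale /=.
by rewrite exprS mulrA -(mulrA (-1)) -expr2 sqrr_sign mulr1 mulN1r opprK.
Qed.

End Regular.

(** * Strict generators *)

Section StrictGenerator.
Variables (R : realType) (psi : R -> R).
Hypotheses (psi_gen : is_generator psi) (psi_strict : is_strict psi).
Local Open Scope classical_set_scope.

Lemma ext_decr (z w : \bar R) : (0 <= z)%E -> (z < w)%E ->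
  ext_infty psi w < ext_infty psi z.
Proof.
have [_ _ _ _ decr] := psi_gen; move=> z0 zw; apply: decr => //.
by rewrite psi_strict leey.
Qed.

Lemma generator_gt0 (z : R) : 0 <= z -> 0 < psi z.
Proof. by move=> z0; apply: (@ext_decr z%:E +oo%E); rewrite ?lee_fin ?ltry. Qed.

Lemma ext_itv (z : \bar R) : (0 <= z)%E -> 0 <= ext_infty psi z <= 1.
Proof.
have [_ psi01 _ _ _] := psi_gen.
by case: z => [z|_|//]; [rewrite lee_fin; exact: psi01|rewrite /= lexx ler01].
Qed.

(** Extended by the value 0 at +oo, a strict generator is a decreasing bijection
    from [0, +oo] onto [0, 1], whose inverse is the pseudo-inverse. Working in
    the extended half-line keeps the boundary point 0 of the cube from being a
    special case. *)
Lemma pseudo_inverseK (z : \bar R) : (0 <= z)%E ->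
  pseudo_inverse psi (ext_infty psi z) = z.
Proof.
move=> z0; rewrite /pseudo_inverse -[RHS]ereal_inf1; congr ereal_inf.
apply/seteqP; split => [w /= [w0 wz]|w /= ->//].
have [wz'|zw|//] := ltgtP w z.
  by have := ext_decr w0 wz'; rewrite wz ltxx.
by have := ext_decr z0 zw; rewrite wz ltxx.
Qed.

Lemma ext_surj (t : R) : 0 <= t <= 1 ->
  exists2 z : \bar R, (0 <= z)%E & ext_infty psi z = t.
Proof.
have [psi_cont psi01 _ [psi0 psioo] _] := psi_gen.
move=> /andP[]; rewrite le_eqVlt => /predU1P[<- _|t0 t1]; first by exists +oo%E.
have [A [Ar HA]] : \forall z \near +oo, `|0 - psi z| < t.
  by move/cvgrPdist_lt : psioo => /(_ _ t0).
pose b := Num.max 0 A + 1.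
have b0 : 0 <= b by rewrite addr_ge0 // le_max lexx.
have psib : psi b < t.
  have : `|0 - psi b| < t by apply: HA; rewrite /b ltr_pwDr // le_max lexx orbT.
  by rewrite sub0r normrN; apply: le_lt_trans; exact: ler_norm.
have [||c] := @IVT R psi 0 b t b0.
- apply: continuous_subspaceW psi_cont => x /=.
  by rewrite !in_itv/= => /andP[->].
- by rewrite psi0 ge_min le_max t1 (ltW psib) orbT.
by rewrite in_itv/= => /andP[c0 _] <-; exists c%:E; rewrite ?lee_fin.
Qed.

Lemma pseudo_inverse_ge0 (t : R) : 0 <= t <= 1 -> (0 <= pseudo_inverse psi t)%E.
Proof. by move=> /ext_surj[z z0 <-]; rewrite pseudo_inverseK. Qed.

Lemma ext_pseudo_inverse (t : R) : 0 <= t <= 1 ->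
  ext_infty psi (pseudo_inverse psi t) = t.
Proof. by move=> /ext_surj[z z0 <-]; rewrite pseudo_inverseK. Qed.

Lemma pseudo_inverse_noninc (s t : R) : 0 <= s <= 1 -> 0 <= t <= 1 -> s <= t ->
  (pseudo_inverse psi t <= pseudo_inverse psi s)%E.
Proof.
move=> s01 t01 st; rewrite leNgt; apply/negP => /ext_decr.
by rewrite !ext_pseudo_inverse // pseudo_inverse_ge0 // ltNge st => /(_ isT).
Qed.

Lemma pseudo_inverse1 : pseudo_inverse psi 1 = 0%E.
Proof.
have [_ _ _ [psi0 _] _] := psi_gen.
by have := @pseudo_inverseK 0%E (lexx _); rewrite /= psi0.
Qed.

Lemma pseudo_inverse_fin (t : R) : 0 < t -> t <= 1 ->
  exists2 z : R, 0 <= z & pseudo_inverse psi t = z%:E.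
Proof.
move=> t0 t1; have t01 : 0 <= t <= 1 by rewrite ltW.
have := pseudo_inverse_ge0 t01; have := ext_pseudo_inverse t01.
case: (pseudo_inverse psi t) => [z _ z0|/= tE|//]; first by exists z.
by rewrite -tE ltxx in t0.
Qed.

End StrictGenerator.

Section ShiftedGenerator.
Variables (R : realType) (n : nat) (f : R -> R) (a : R).
Hypotheses (f_reg : regular n.+2 f) (a0 : 0 < a).
Local Open Scope classical_set_scope.

(** With f the l-th derivative of the generator and a the sum of the
    pseudo-inverses of the conditioning values, this generates the conditional
    copula; the sign of f cancels. *)
Definition shifted_generator (z : R) : R := f (a + z) / f a.

Lemma shifted_generator_gt0 z : 0 <= z -> 0 < shifted_generator z.
Proof.
have [_ fpos _] := f_reg.
by move=> z0; rewrite /shifted_generator divr_gt0 ?fpos // ltr_pwDl.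
Qed.

Lemma shifted_generator_decr z w : 0 <= z -> z < w ->
  shifted_generator w < shifted_generator z.
Proof.
have [_ fpos _] := f_reg.
move=> z0 zw; rewrite ltr_pM2r ?invr_gt0 ?fpos //.
have -> : a + w = (a + z) + (w - z) by lra.
apply: (regular_decr f_reg); first exact: ltr_pwDl.
by rewrite subr_gt0.
Qed.

Lemma shifted_generator_is_generator : is_generator shifted_generator.
Proof.
have [fn fpos fvan] := f_reg.
have noninc z w : 0 <= z -> z <= w -> shifted_generator w <= shifted_generator z.
  move=> z0; rewrite le_eqVlt => /predU1P[->//|zw].
  by rewrite ltW // shifted_generator_decr.
have g0 : shifted_generator 0 = 1.
  by rewrite /shifted_generator addr0 divff // gt_eqF ?fpos.
split => //.
- apply: continuous_in_subspaceT => z; rewrite inE /= in_itv/= andbT => z0.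
  apply: cvgMl.
  apply: (@continuous_comp _ _ _ (fun z => a + z) f).
    by apply: cvgD; [exact: cvg_cst|exact: cvg_id].
  by apply: (diff_monotone_continuous fn); rewrite ltr_pwDl.
- by move=> z z0; rewrite ltW ?shifted_generator_gt0 //= -g0 noninc.
- split=> //; apply/cvgrPdist_lt => e e0.
  have [A A0 HA] := fvan (e * f a) (mulr_gt0 e0 (fpos a a0)).
  near=> z.
  have z0 : A <= z by near: z; apply: nbhs_pinfty_ge; rewrite num_real.
  rewrite sub0r normrN gtr0_norm.
    by rewrite ltr_pdivrMr ?fpos //; apply: HA; rewrite ler_wpDl // ltW.
  by rewrite shifted_generator_gt0 // (le_trans _ z0) // ltW.
- move=> [z| |] [w| |] //=; rewrite ?lee_fin ?lte_fin => z0 zw _.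
    exact: shifted_generator_decr.
  exact: shifted_generator_gt0.
Unshelve. all: by end_near. Qed.

Lemma shifted_generator_is_strict : is_strict shifted_generator.
Proof.
rewrite /is_strict /pseudo_inverse -[RHS]ereal_inf1; congr ereal_inf.
apply/seteqP; split => [[z| |] [z0 gz]//|_ ->]; last by split; rewrite ?leey.
rewrite lee_fin in z0.
by move: gz (shifted_generator_gt0 z0) => /= ->; rewrite ltxx.
Qed.

End ShiftedGenerator.

Lemma adiff_shifted_generator (R : realType) (f : R -> R) (a : R) hs z :
  adiff (shifted_generator f a) hs z = adiff f hs (a + z) / f a.
Proof.
by elim: hs z => //= h hs IH z; rewrite !IH -mulrBl addrA.
Qed.

(** * Iterated differences and volumes of boxes *)

Section FromCopula.
Variables (R : realType) (d : nat) (psi : R -> R) (C : ('I_d -> R) -> R).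
Hypotheses (psiC : archimedean_with psi C) (psi_strict : is_strict psi).
Local Open Scope classical_set_scope.

(** The base point z is shared equally between the d coordinates: the difference
    is the volume of the box with upper corner psi (z / d) in every coordinate
    and lower corner psi (z / d + h_i). *)
Lemma archimedean_adiff_ge0 (hs : seq R) (z : R) :
  (0 < d)%N -> size hs = d -> all (fun h => 0 <= h) hs -> 0 < z ->
  0 <= adiff psi hs z.
Proof.
have [psi_gen [_ _ vol] CE] := psiC.
move=> d0 shs /all_nthP - /(_ 0) hs0 z0.
pose h (i : 'I_d) := nth 0 hs i.
have h0 i : 0 <= h i by apply: hs0; rewrite shs.
have zd0 : 0 <= z / d%:R by rewrite divr_ge0 // ltW.
have [_ psi01 noninc _ _] := psi_gen.
have zh0 i : 0 <= z / d%:R + h i by rewrite addr_ge0.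
pose a i := psi (z / d%:R + h i); pose b (i : 'I_d) := psi (z / d%:R).
have vol0 := vol a b (fun i => psi01 _ (zh0 i)) (fun=> psi01 _ zd0) _.
apply: le_trans (vol0 _) _ => [i|]; first by rewrite noninc // lerDl.
have -> : hs = [seq h i | i <- enum 'I_d].
  rewrite (map_comp (nth 0 hs) val) val_enum_ord -[LHS](mkseq_nth 0).
  by rewrite /mkseq shs.
rewrite -sum_sets_adiff le_eqVlt; apply/orP; left; apply/eqP.
apply: eq_bigr => S _; congr (_ * _).
rewrite CE; last first.
  by move=> i; case: ifP => _; apply: psi01.
have -> : (\sum_(i < d) pseudo_inverse psi (if i \in S then a i else b i) =
    (z + \sum_(i in S) h i)%:E)%E; last by [].
rewrite [\sum_(i in S) _]big_mkcond /=.
have {1}-> : z = \sum_(i < d) z / d%:R.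
  rewrite sumr_const card_ord -[LHS](@divfK _ d%:R) ?mulr_natr //.
  by rewrite pnatr_eq0 -lt0n.
rewrite -big_split /= -sumEFin; apply: eq_bigr => i _.
have psiK y : 0 <= y -> pseudo_inverse psi (psi y) = y%:E.
  by move=> y0; apply: (pseudo_inverseK psi_gen psi_strict (z := y%:E)).
by case: ifP => _; rewrite psiK // addr0.
Qed.

Lemma adiff_cvgy (f : R -> R) (hs : seq R) :
  f z @[z --> +oo] --> 0 -> adiff f hs z @[z --> +oo] --> 0.
Proof.
move=> f0; elim: hs => //= h hs IH; rewrite -(subr0 0); apply: cvgB => //.
apply: (cvg_comp (fun z => z + h) (adiff f hs)) IH.
exact: cvg_addrr.
Qed.

(** Differences of order less than d follow from those of order d by sending the
    superfluous steps to +oo, where psi vanishes. *)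
Lemma archimedean_diff_monotone : (0 < d)%N -> diff_monotone d psi.
Proof.
have [psi_gen _ _] := psiC.
have [_ _ _ [_ psioo] _] := psi_gen.
move=> d0 hs; move: {2}(d - size hs)%N (erefl (d - size hs)%N) => k.
elim: k hs => [|k IH] hs kE shs hs0 z z0.
  apply: archimedean_adiff_ge0 => //; apply/eqP; rewrite eqn_leq shs.
  by rewrite -subn_eq0 kE.
rewrite -(subr0 (adiff _ _ _)).
have cv : adiff psi hs z - adiff psi hs (z + h) @[h --> +oo]
    --> adiff psi hs z - 0.
  apply: cvgB; first exact: cvg_cst.
  apply: (cvg_comp (fun h => z + h) (adiff psi hs)) (adiff_cvgy _ psioo).
  exact: cvg_addrl.
apply: (cvgr_to_ge cv); near=> h.
have h0 : 0 <= h by near: h; apply: nbhs_pinfty_ge; rewrite num_real.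
apply: (IH (h :: hs)) => //=; last by rewrite h0.
  by rewrite subnS kE.
by rewrite -subn_gt0 kE.
Unshelve. all: by end_near. Qed.

Lemma archimedean_regular : (0 < d)%N -> regular d psi.
Proof.
move=> d0; have [psi_gen _ _] := psiC.
have [_ _ _ [_ psioo] _] := psi_gen.
split; first exact: archimedean_diff_monotone.
  by move=> z z0; apply: (generator_gt0 psi_gen psi_strict); exact: ltW.
move=> e e0.
have [A [_ HA]] : \forall z \near +oo, `|0 - psi z| < e.
  by move/cvgrPdist_lt : psioo => /(_ _ e0).
exists (Num.max 0 A + 1); first by rewrite ltr_pwDr // le_max lexx.
move=> z Az; have : `|0 - psi z| < e.
  by apply: HA; apply: lt_le_trans Az; rewrite ltr_pwDr // le_max lexx orbT.
by rewrite sub0r normrN; apply: le_lt_trans; exact: ler_norm.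
Qed.

End FromCopula.

Section ToCopula.
Variables (R : realType) (n : nat) (psi : R -> R).
Hypotheses (psi_gen : is_generator psi) (psi_strict : is_strict psi).
Hypothesis psi_mon : forall hs : seq R, (size hs <= n)%N ->
  all (fun h => 0 <= h) hs -> forall z, 0 <= z -> 0 <= adiff psi hs z.

(** An infinite step subtracts 0, so it can be dropped. *)
Lemma adiff_extE (hs : seq \bar R) : all (fun h => 0 <= h)%E hs ->
  exists ks : seq R, [/\ (size ks <= size hs)%N, all (fun k => 0 <= k) ks
    & forall z : R, adiff (ext_infty psi) hs z%:E = adiff psi ks z].
Proof.
elim: hs => [_|h hs IH /= /andP[h0 hs0]]; first by exists [::].
have [ks [sks ks0 ksE]] := IH hs0.
have adiffy : adiff (ext_infty psi) hs +oo%E = 0.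
  elim: hs hs0 {IH sks ksE} => //= k hs IH /andP[k0 hs0].
  have -> : (+oo%E : \bar R) + k = +oo%E by case: k k0.
  by rewrite IH // subr0.
case: h h0 => [h h0|_|//].
  exists (h :: ks); split => //=; first by rewrite -lee_fin h0.
  by move=> z; rewrite (ksE z) (ksE (z + h)).
exists ks; split => //; first exact: ltnW.
by move=> z; rewrite ksE -[RHS]subr0 -adiffy.
Qed.

(** The converse of [archimedean_diff_monotone]. In the coordinates given by the
    pseudo-inverse, the volume of a box is an iterated difference whose steps are
    infinite in the coordinates where the lower corner is 0. A box whose upper
    corner has a coordinate 0 is treated apart: its volume is 0. *)
Lemma archimedean_is_copula (C : ('I_n -> R) -> R) :
  (forall u, in_cube u ->
    C u = ext_infty psi (\sum_(i < n) pseudo_inverse psi (u i))%E) ->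
  is_copula C.
Proof.
move=> CE.
have pge0 := pseudo_inverse_ge0 psi_gen psi_strict.
have C0 u i : in_cube u -> u i = 0 -> C u = 0.
  move=> u01 ui0; rewrite CE //.
  suff -> : (\sum_(i < n) pseudo_inverse psi (u i))%E = +oo%E by [].
  have noy j : xpredT j -> pseudo_inverse psi (u j) != -oo%E.
    by move=> _; rewrite gt_eqF // (lt_le_trans _ (pge0 _ (u01 j))).
  apply: (proj2 (esum_eqyP _ noy)).
  by exists i; split => //; [rewrite mem_index_enum|rewrite ui0].
split=> [u u01 [i ui0]|u i u01 ui|a b a01 b01 ab].
- exact: C0 ui0.
- rewrite CE // (bigD1 i) //= big1 ?adde0.
    exact: (ext_pseudo_inverse psi_gen psi_strict).
  by move=> j ji; rewrite ui // (pseudo_inverse1 psi_gen psi_strict).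
have c01 (S : {set 'I_n}) : in_cube (fun i => if i \in S then a i else b i).
  by move=> i; case: ifP.
have [[i bi0]|nb0] := pselect (exists i, b i = 0).
  rewrite big1 // => S _; rewrite (C0 _ i) ?mulr0 //=.
  case: ifP => // _; apply/eqP; rewrite eq_le; have /andP[-> _] := a01 i.
  by rewrite andbT -bi0.
have b0 i : 0 < b i.
  have /andP[+ _] := b01 i; rewrite le_eqVlt => /predU1P[bi0|//].
  by case: nb0; exists i.
pose s i := fine (pseudo_inverse psi (b i)).
have sE i : pseudo_inverse psi (b i) = (s i)%:E.
  have /andP[_ b1] := b01 i.
  have [z _ zE] := pseudo_inverse_fin psi_gen psi_strict (b0 i) b1.
  by rewrite /s zE.
have s0 i : 0 <= s i by rewrite -lee_fin -sE; exact: pge0.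
pose h i : \bar R := (pseudo_inverse psi (a i) - (s i)%:E)%E.
have h0 i : (0 <= h i)%E.
  rewrite /h sube_ge0 // -sE.
  exact: (pseudo_inverse_noninc psi_gen psi_strict).
have hE i : pseudo_inverse psi (a i) = ((s i)%:E + h i)%E.
  by rewrite /h addeC subeK.
have [ks [sks ks0 ksE]] : exists ks : seq R, [/\ (size ks <= n)%N,
    all (fun k => 0 <= k) ks & forall z : R,
    adiff (ext_infty psi) [seq h i | i <- enum 'I_n] z%:E = adiff psi ks z].
  have [|ks] := @adiff_extE [seq h i | i <- enum 'I_n].
    by apply/allP => _ /mapP[i _ ->].
  by rewrite size_map size_enum_ord; exists ks.
have sum0 : 0 <= \sum_(i < n) s i by rewrite sumr_ge0.
have := psi_mon sks ks0 sum0.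
move=> /le_trans; apply; rewrite -ksE -sum_sets_adiff.
rewrite le_eqVlt; apply/orP; left; apply/eqP; apply: eq_bigr => S _.
rewrite CE //; congr (_ * ext_infty _ _).
rewrite -sumEFin [X in _ + X]big_mkcond -big_split /=.
apply: eq_bigr => i _; case: ifP => _; first by rewrite hE.
by rewrite sE addr0.
Qed.

End ToCopula.

(** * The conditional copula *)

Section Conditional.
Context {R : realType}.
Variables (l : nat) (psi : R -> R) (x : 'I_l -> R).
Hypotheses (psi_gen : is_generator psi) (psi_strict : is_strict psi).
Hypotheses (l0 : (0 < l)%N) (hx : forall i, 0 < x i < 1).

Lemma sum_pseudo_inverse_gt0 : exists2 a : R, 0 < a &
  (\sum_(i < l) pseudo_inverse psi (x i))%E = a%:E.
Proof.
have pos i : exists2 z : R, 0 < z & pseudo_inverse psi (x i) = z%:E.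
  have /andP[x0 x1] := hx i.
  have [z z0 zE] := pseudo_inverse_fin psi_gen psi_strict x0 (ltW x1).
  exists z => //; rewrite lt_neqAle z0 andbT; apply/eqP => z00.
  have x01 : 0 <= x i <= 1 by rewrite !ltW.
  have := ext_pseudo_inverse psi_gen psi_strict x01.
  have [_ _ _ [psi0 _] _] := psi_gen.
  by rewrite zE -z00 /= psi0 => x1'; rewrite -x1' ltxx in x1.
exists (\sum_(i < l) fine (pseudo_inverse psi (x i))); last first.
  by rewrite -sumEFin; apply: eq_bigr => i _; have [z _ ->] := pos i.
rewrite (bigD1 (Ordinal l0)) //= ltr_wpDr //; last first.
  by have [z ? ->] := pos (Ordinal l0).
by apply: sumr_ge0 => i _; have [z /ltW ? ->] := pos i.
Qed.

Variable a : R.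
Hypothesis aE : (\sum_(i < l) pseudo_inverse psi (x i))%E = a%:E.
Local Notation g := (shifted_generator (psi^`(l))%classic a).
Hypotheses (g_gen : is_generator g) (g_strict : is_strict g).

Lemma ext_shifted_generator (z : \bar R) :
  ext_infty (psi^`(l))%classic (a%:E + z)%E / ext_infty (psi^`(l))%classic a%:E
  = ext_infty g z.
Proof. by case: z => [z| |] //=; rewrite mul0r. Qed.

(** The margin is [ext_infty g] after the pseudo-inverse of psi. Both are
    bijections, so the quantile composed with the pseudo-inverse of psi is the
    pseudo-inverse of g. *)
Lemma kernel_quantileP (u : R) : 0 <= u <= 1 ->
  0 <= kernel_quantile psi x u <= 1
  /\ pseudo_inverse psi (kernel_quantile psi x u) = pseudo_inverse g u.
Proof.
move=> u01.
have marginE y : kernel_margin psi x y = ext_infty g (pseudo_inverse psi y).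
  by rewrite /kernel_margin aE ext_shifted_generator.
have surj : set_surj `[0, 1]%classic `[0, 1]%classic (kernel_margin psi x).
  move=> v /=; rewrite in_itv/= => v01.
  have [z z0 zv] := ext_surj g_gen v01.
  exists (ext_infty psi z).
    by rewrite /= in_itv/=; exact: (ext_itv psi_gen).
  by rewrite marginE (pseudo_inverseK psi_gen psi_strict).
have q01 : 0 <= kernel_quantile psi x u <= 1.
  have := surjpinv_image_sub (dflt := fun=> 0) surj.
  move=> /(_ (kernel_quantile psi x u)) /=; rewrite in_itv/=; apply.
  by exists u => //=; rewrite in_itv.
split => //.
have qK : kernel_margin psi x (kernel_quantile psi x u) = u.
  by apply: (surjpK _ surj); rewrite inE /= in_itv.
rewrite -[in RHS]qK marginE (pseudo_inverseK g_gen g_strict) //.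
exact: (pseudo_inverse_ge0 psi_gen psi_strict).
Qed.

Lemma conditional_copulaE n (u : 'I_n -> R) : in_cube u ->
  conditional_copula psi x u
  = ext_infty g (\sum_(j < n) pseudo_inverse g (u j))%E.
Proof.
move=> u01; rewrite /conditional_copula /markov_kernel aE ext_shifted_generator.
congr (ext_infty _ _); apply: eq_bigr => j _.
by have [_ ->] := kernel_quantileP (u01 j).
Qed.

End Conditional.

Theorem proposition6p2 (R : realType) (d l : nat)
    (hl : (1 <= l <= d - 2)%N)
    (C : ('I_d -> R) -> R) (psi : R -> R)
    (hC : archimedean_with psi C) (hstrict : is_strict psi)
    (x : 'I_l -> R) (hx : forall i, 0 < x i < 1) :
  archimedean_copula (fun u : 'I_(d - l) -> R => conditional_copula psi x u).
Proof.
have /andP[l0 ld] := hl.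
have [psi_gen _ _] := hC.
have l2d : (l.+2 <= d)%N.
  have d2 : (2 <= d)%N by rewrite ltnW // -subn_gt0 (leq_trans l0).
  by rewrite leq_subRL in ld.
have [a a0 aE] := sum_pseudo_inverse_gt0 psi_gen hstrict l0 hx.
set D := (psi^`(l))%classic.
pose f z := (-1) ^+ l * D z.
have f_reg : regular (d - l) f.
  apply: regular_derive1n => //; apply: (archimedean_regular hC hstrict).
  by apply: leq_trans l2d.
have fD : shifted_generator f a = shifted_generator D a.
  apply/funext => z; rewrite /shifted_generator /f -mulf_div divff ?mul1r //.
  by rewrite signr_eq0.
have [f_mon f_gt0 _] := f_reg.
have dlE : (d - l = (d - l.+2).+2)%N by rewrite -{1}(subnK l2d) -2!addSnnS addnK.
have f_reg2 : regular (d - l.+2).+2 f by rewrite -dlE.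
have g_gen := shifted_generator_is_generator f_reg2 a0.
have g_strict := shifted_generator_is_strict f_reg2 a0.
have CE (u : 'I_(d - l) -> R) : in_cube u -> conditional_copula psi x u =
    ext_infty (shifted_generator f a)
      (\sum_(j < d - l) pseudo_inverse (shifted_generator f a) (u j))%E.
  by move=> u01; rewrite fD; apply: conditional_copulaE => //; rewrite -/D -fD.
exists (shifted_generator f a); split => //.
apply: (archimedean_is_copula g_gen g_strict) => // hs shs hs0 z z0.
rewrite adiff_shifted_generator divr_ge0 //; last exact/ltW/f_gt0.
by apply: f_mon => //; rewrite ltr_pwDl.
Qed.
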